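(* Let $\mathcal{C}\subset(\mathbb{C}^2)^{\otimes n}$ be a stabilizer code on $n$ qubits encoding one logical qubit, with minimal set of stabilizer generators $g_1,\dots,g_{n-1}$. For $\mathbf{s}\in\{0,1\}^{n-1}$ let $\Pi_{\mathbf{s}}=\prod_{i=1}^{n-1}\frac{\mathbb{I}+(-1)^{s_i}g_i}{2}$ (so $\Pi_{\mathbf{0}}$ is the projector onto the code space), and for each $\mathbf{s}$ let $C_{\mathbf{s}}$ be any Pauli operator with $\Pi_{\mathbf{s}}C_{\mathbf{s}}=C_{\mathbf{s}}\Pi_{\mathbf{0}}$ (a recovery operation). Let $U$ be a unitary on the $n$ physical qubits. Assume: (1) every element of the stabilizer group has even Pauli weight; (2) the code is CSS and its $X$- and $Z$-distances $d_x$, $d_z$ are both odd; (3) $U$ commutes with the antiunitary time-reversal operator $\mathcal{T}=\mathcal{K}\prod_{j=1}^n(iY_j)$, where $\mathcal{K}$ denotes complex conjugation in the computational basis. Then for every $\mathbf{s}$, $$C_{\mathbf{s}}\Pi_{\mathbf{s}}U\Pi_{\mathbf{0}}=\sqrt{p(\mathbf{s})}\,U_{L,\mathbf{s}}\Pi_{\mathbf{0}},$$ where $p(\mathbf{s})$ is a probability distribution over syndromes $\mathbf{s}\in\{0,1\}^{n-1}$ and each $U_{L,\mathbf{s}}$ is a unitary on the logical subspace (code space).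
   Context: The Pauli weight $|P|$ of a Pauli string $P$ is the number of tensor factors that are not the identity. A stabilizer code is CSS if its stabilizer group is generated by operators that are each tensor products of only $X$ and $I$, or only of $Z$ and $I$; $d_x$ and $d_z$ are the minimal weights of nontrivial logical $X$-type and $Z$-type operators. $Y_j$ denotes the Pauli $Y$ on qubit $j$. A ''unitary on the logical subspace'' means an operator on the code space $\Pi_{\mathbf{0}}(\mathbb{C}^2)^{\otimes n}$ that is unitary there. *)

(* Defs.v *)
From HB Require Import structures.
From mathcomp Require Import all_boot all_order all_algebra.
From mathcomp Require Import complex.
From mathcomp Require Export reals.
Set Implicit Arguments.
Unset Strict Implicit.
Unset Printing Implicit Defensive.
Import Order.TTheory GRing.Theory Num.Theory.
Local Open Scope ring_scope.

Inductive letter := LI | LX | LY | LZ.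

Definition is_id (l : letter) : bool := if l is LI then true else false.
Definition is_xl (l : letter) : bool :=
  match l with LI | LX => true | _ => false end.
Definition is_zl (l : letter) : bool :=
  match l with LI | LZ => true | _ => false end.

Section Paulis.
Variable C : numClosedFieldType.

(* Entry (a,b) (row a, column b, computational basis |0>,|1> <-> false,true)
   of the single-qubit Pauli matrices I, X, Y = [[0,-i],[i,0]], Z. *)
Definition lmx (l : letter) (a b : bool) : C :=
  match l with
  | LI => (a == b)%:R
  | LX => (a != b)%:R
  | LY => if a == b then 0 else if a then 'i else - 'i
  | LZ => if a == b then (if a then -1 else 1) else 0
  end.

(* The computational basis state with index a : 'I_(2^n) has qubit j
   in state |bit j of a>. *)
Definition qbit (n : nat) (a : 'I_(2 ^ n)) (j : 'I_n) : bool := odd (a %/ 2 ^ j).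

(* A Pauli operator on n qubits: phase i^k times a Pauli string. *)
Record pauli (n : nat) := Pauli { pphase : nat; pstr : 'I_n -> letter }.

Definition pmx (n : nat) (P : pauli n) : 'M[C]_(2 ^ n) :=
  ('i ^+ pphase P) *: \matrix_(a, b) \prod_(j < n) lmx (pstr P j) (qbit a j) (qbit b j).

Definition pweight (n : nat) (P : pauli n) : nat := #|[pred j | ~~ is_id (pstr P j)]|.

Definition adj (N : nat) (A : 'M[C]_N) : 'M[C]_N := (map_mx Num.conj A)^T.

Definition unitary (N : nat) (A : 'M[C]_N) : Prop :=
  A *m adj A = 1%:M /\ adj A *m A = 1%:M.

Inductive gen_in (N k : nat) (P : pred 'I_k) (gs : 'I_k -> 'M[C]_N) : 'M[C]_N -> Prop :=
  | gen_one : gen_in P gs 1%:M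
  | gen_mul (i : 'I_k) (M : 'M[C]_N) : P i -> gen_in P gs M -> gen_in P gs (gs i *m M).

Definition stab_group (n k : nat) (g : 'I_k -> pauli n) : 'M[C]_(2 ^ n) -> Prop :=
  gen_in predT (fun i => pmx (g i)).

Definition stabilizer_generators (n k : nat) (g : 'I_k -> pauli n) : Prop :=
  [/\ forall i j, pmx (g i) *m pmx (g j) = pmx (g j) *m pmx (g i),
      ~ stab_group g (- 1%:M)
    & forall i, ~ gen_in (predC1 i) (fun j => pmx (g j)) (pmx (g i))].

Definition syndrome (k : nat) := {ffun 'I_k -> bool}.

Definition synd_proj (n k : nat) (g : 'I_k -> pauli n) (s : syndrome k) : 'M[C]_(2 ^ n) :=
  \big[mulmx/1%:M]_(i < k) (2^-1 *: (1%:M + (if s i then -1 else 1) *: pmx (g i))).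

Definition synd0 (k : nat) : syndrome k := [ffun => false].

Definition code_proj (n k : nat) (g : 'I_k -> pauli n) : 'M[C]_(2 ^ n) :=
  synd_proj g (synd0 k).

Definition is_CSS (n k : nat) (g : 'I_k -> pauli n) : Prop :=
  exists (m : nat) (h : 'I_m -> pauli n),
    (forall j, (forall q, is_xl (pstr (h j) q)) \/ (forall q, is_zl (pstr (h j) q)))
    /\ (forall M, stab_group g M <-> stab_group h M).

Definition nontrivial_logical (n k : nat) (g : 'I_k -> pauli n) (P : pauli n) : Prop :=
  (forall i, pmx (g i) *m pmx P = pmx P *m pmx (g i)) /\
  ~ (exists (c : C) (M : 'M[C]_(2 ^ n)), stab_group g M /\ pmx P = c *: M).

Definition is_type_distance (typ : letter -> bool) (n k : nat) (g : 'I_k -> pauli n)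
  (d : nat) : Prop :=
  (exists P : pauli n, (forall q, typ (pstr P q)) /\ nontrivial_logical g P /\ pweight P = d)
  /\ (forall P : pauli n, (forall q, typ (pstr P q)) -> nontrivial_logical g P ->
        (d <= pweight P)%N).

Definition TRmx (n : nat) : 'M[C]_(2 ^ n) :=
  \matrix_(a, b) \prod_(j < n) ('i * lmx LY (qbit a j) (qbit b j)).

Definition time_reversal (n : nat) (psi : 'cV[C]_(2 ^ n)) : 'cV[C]_(2 ^ n) :=
  map_mx Num.conj (TRmx n *m psi).

Definition commutes_with_TR (n : nat) (U : 'M[C]_(2 ^ n)) : Prop :=
  forall psi : 'cV[C]_(2 ^ n), time_reversal (U *m psi) = U *m time_reversal psi.

Definition logical_unitary (n k : nat) (g : 'I_k -> pauli n) (L : 'M[C]_(2 ^ n)) : Prop :=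
  [/\ code_proj g *m L *m code_proj g = L,
      adj L *m L = code_proj g
    & L *m adj L = code_proj g].

End Paulis.

(* Main.v *)
Require Import Defs.
From HB Require Import structures.
From mathcomp Require Import all_boot all_order all_algebra.
From mathcomp Require Import complex.
From mathcomp Require Import reals.
From mathcomp Require Import ring.
Import Order.TTheory GRing.Theory Num.Theory.
Local Open Scope ring_scope.
Local Open Scope complex_scope.
Set Implicit Arguments.
Unset Strict Implicit.
Unset Printing Implicit Defensive.

(** The Kraus operator [K = C_s Pi_s U Pi_0] maps the code space to itself, and
    [A = K^* K = Pi_0 U^* Pi_s U Pi_0] is Hermitian. Stabilizers of even weight commute with
    the antiunitary [T], hence so does [A]. If [n] is odd then [T^2 = -1], and
    Kramers degeneracy on the two-dimensional code space forces [A] to be a multiple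
    [p(s) Pi_0]; so [K] is [sqrt (p(s))] times a unitary of the code space, and the
    [p(s)] sum to 1 because the [Pi_s] do.

    To see that [n] is odd: for a CSS code whose stabilizers have even weight, [X^n] and
    [Z^n] commute with the stabilizer. A logical [Z]-type operator of odd weight
    anticommutes with [X^n], and a logical [X]-type operator of odd weight anticommutes
    with [Z^n]. For [n] even, [X^n] and [Z^n] would commute; the [X^n = 1] part of the
    code space is a line, preserved by both [Z^n] and the [X]-type operator, which
    nevertheless anticommute. *)

(** * Basis indices as bit strings *)

Lemma odd_divX_inj (n a b : nat) :
  (a < 2 ^ n)%N -> (b < 2 ^ n)%N ->
  (forall j, (j < n)%N -> odd (a %/ 2 ^ j) = odd (b %/ 2 ^ j)) -> a = b.
Proof.
elim: n a b => [|n IHn] a b; first by case: a b => [|a] [|b].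
rewrite expnSr => a_lt b_lt eq_ab.
have eq2 : (a %/ 2 = b %/ 2)%N.
  apply: IHn; rewrite ?ltn_divLR // => j j_lt.
  by rewrite -!divnMA -expnS; apply: eq_ab.
have := eq_ab 0 isT; rewrite expn0 !divn1 => eq_odd.
by rewrite (divn_eq a 2) (divn_eq b 2) eq2 !modn2 eq_odd.
Qed.

Definition qbits n (a : 'I_(2 ^ n)) : {ffun 'I_n -> bool} := [ffun j => qbit a j].

Lemma qbits_inj n : injective (@qbits n).
Proof.
move=> a b /ffunP eq_ab.
apply/val_inj/(odd_divX_inj (ltn_ord a) (ltn_ord b)) => j j_lt.
by have := eq_ab (Ordinal j_lt); rewrite !ffunE.
Qed.

Lemma qbits_bij n : bijective (@qbits n).
Proof.
apply: inj_card_bij; first exact: qbits_inj.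
by rewrite card_ffun !card_ord card_bool.
Qed.

(** * Tensor products of 2 by 2 matrices *)

Section Tensor.
Variables (C : numClosedFieldType) (n : nat).
Implicit Types f g : 'I_n -> bool -> bool -> C.

(** Distributivity of product over sum, after the indices below [2 ^ n] are replaced by bit strings.
    It reduces products and traces of tensors to one qubit at a time. *)
Lemma sum_qbit_prod (F : 'I_n -> bool -> C) :
  \sum_(c < 2 ^ n) \prod_j F j (qbit c j) = \prod_j \sum_c F j c.
Proof.
rewrite bigA_distr_bigA (reindex _ (onW_bij _ (@qbits_bij n))).
by apply: eq_bigr => c _; apply: eq_bigr => j _; rewrite ffunE.
Qed.

Definition tens f : 'M[C]_(2 ^ n) :=
  \matrix_(a, b) \prod_(j < n) f j (qbit a j) (qbit b j).

Lemma eq_tens f g : (forall j a b, f j a b = g j a b) -> tens f = tens g.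
Proof.
by move=> eq_fg; apply/matrixP => a b; rewrite !mxE; apply: eq_bigr => j _.
Qed.

Lemma tens_mul f g :
  tens f *m tens g = tens (fun j a b => \sum_c f j a c * g j c b).
Proof.
apply/matrixP => a b; rewrite !mxE -sum_qbit_prod.
by apply: eq_bigr => c _; rewrite !mxE -big_split.
Qed.

Lemma tensZ (s : 'I_n -> C) f :
  tens (fun j a b => s j * f j a b) = (\prod_j s j) *: tens f.
Proof. by apply/matrixP => a b; rewrite !mxE big_split. Qed.

Lemma tens1 : tens (fun _ a b => (a == b)%:R) = 1%:M.
Proof.
apply/matrixP => a b; rewrite !mxE; have [->|neq_ab] := eqVneq a b.
  by apply: big1 => j _; rewrite eqxx.
have [j neq_j] : exists j, qbit a j != qbit b j.
  apply/existsP; apply: contra_neqT neq_ab; rewrite negb_exists => /forallP eqj.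
  by apply: qbits_inj; apply/ffunP => j; rewrite !ffunE; apply/eqP/negPn/eqj.
by rewrite (bigD1 j) //= (negPf neq_j) mul0r.
Qed.

Lemma tr_tens f : \tr (tens f) = \prod_j \sum_c f j c c.
Proof. by rewrite -sum_qbit_prod; apply: eq_bigr => a _; rewrite !mxE. Qed.

Lemma conj_tens f : map_mx Num.conj (tens f) = tens (fun j a b => Num.conj (f j a b)).
Proof. by apply/matrixP => a b; rewrite !mxE rmorph_prod. Qed.

Lemma trmx_tens f : (tens f)^T = tens (fun j a b => f j b a).
Proof. by apply/matrixP => a b; rewrite !mxE. Qed.

End Tensor.

(** * Products and commutation signs of single-qubit Paulis *)

Definition lmul (l m : letter) : letter :=
  match l, m with
  | LI, m => m | l, LI => l
  | LX, LX | LY, LY | LZ, LZ => LI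
  | LX, LY | LY, LX => LZ
  | LY, LZ | LZ, LY => LX
  | LX, LZ | LZ, LX => LY
  end.

(** The power of ['i] that [lmul] drops: [XY = iZ], whereas [YX = -iZ] has exponent 3. *)
Definition lmul_phase (l m : letter) : nat :=
  match l, m with
  | LX, LY | LY, LZ | LZ, LX => 1
  | LY, LX | LZ, LY | LX, LZ => 3
  | _, _ => 0
  end.

Definition lanti (l m : letter) : bool :=
  match l, m with
  | LI, _ | _, LI | LX, LX | LY, LY | LZ, LZ => false
  | _, _ => true
  end.

Lemma lmul_id l m : is_id (lmul l m) -> l = m.
Proof. by case: l; case: m. Qed.

Section Pauli.
Variable C : numClosedFieldType.

Lemma lmxM l m a b :
  \sum_c lmx C l a c * lmx C m c b = 'i ^+ lmul_phase l m * lmx C (lmul l m) a b.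
Proof.
have ii : 'i * 'i = -1 :> C by rewrite -expr2 sqrCi.
by rewrite big_bool /=; case: l; case: m; case: a; case: b => /=; ring: ii.
Qed.

Lemma lmx_comm l m a b :
  \sum_c lmx C l a c * lmx C m c b =
  (-1) ^+ lanti l m * \sum_c lmx C m a c * lmx C l c b.
Proof.
have ii : 'i * 'i = -1 :> C by rewrite -expr2 sqrCi.
by rewrite !big_bool /=; case: l; case: m; case: a; case: b => /=; ring: ii.
Qed.

Lemma conj_lmx l a b : Num.conj (lmx C l b a) = lmx C l a b.
Proof.
by case: l; case: a; case: b;
  rewrite /= ?rmorphN /= ?conjCi ?opprK ?rmorph1 ?rmorph0.
Qed.

(** [X] and [Z] are real and anticommute with [Y], while [Y] is imaginary and commutes with itself:
    time reversal flips the sign of all three. *)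
Lemma lmx_TR l a b :
  \sum_c ('i * lmx C LY a c) * Num.conj (lmx C l c b) =
  (-1) ^+ (~~ is_id l) * \sum_c lmx C l a c * ('i * lmx C LY c b).
Proof.
have ii : 'i * 'i = -1 :> C by rewrite -expr2 sqrCi.
rewrite !big_bool /= !conj_lmx.
by case: l; case: a; case: b => /=; ring: ii.
Qed.
End Pauli.

(** * Pauli operators on [n] qubits and the time-reversal matrix *)

Section PauliOperators.
Variables (C : numClosedFieldType) (n : nat).
Implicit Types P Q : pauli n.

Lemma pmxE P : pmx C P = 'i ^+ pphase P *: tens (fun j => lmx C (pstr P j)).
Proof. by []. Qed.

Definition pmul P Q : pauli n :=
  Pauli (pphase P + pphase Q + \sum_j lmul_phase (pstr P j) (pstr Q j))%N
        (fun j => lmul (pstr P j) (pstr Q j)).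

Lemma pmxM P Q : pmx C P *m pmx C Q = pmx C (pmul P Q).
Proof.
rewrite !pmxE -scalemxAl -scalemxAr scalerA tens_mul.
rewrite (eq_tens (fun j => lmxM C (pstr P j) (pstr Q j))) tensZ scalerA.
by rewrite -!expr_sum -!exprD.
Qed.

Lemma pmx_comm P Q :
  pmx C P *m pmx C Q =
  (\prod_j (-1) ^+ lanti (pstr P j) (pstr Q j)) *: (pmx C Q *m pmx C P).
Proof.
rewrite !pmxE -!scalemxAl -!scalemxAr !scalerA !tens_mul.
rewrite (eq_tens (fun j => lmx_comm C (pstr P j) (pstr Q j))) tensZ scalerA.
by congr (_ *: _); ring.
Qed.

Lemma conjXi k : Num.conj ('i ^+ k) = (-1) ^+ k * 'i ^+ k :> C.
Proof. by rewrite rmorphXn /= conjCi -exprNn. Qed.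

Lemma adj_pmx P : adj (pmx C P) = (-1) ^+ pphase P *: pmx C P.
Proof.
rewrite /adj !pmxE map_mxZ linearZ /= conj_tens trmx_tens conjXi scalerA.
by rewrite (eq_tens (fun j => conj_lmx C (pstr P j))).
Qed.

Lemma pmx_sq P : pmx C P *m pmx C P = (-1) ^+ pphase P *: 1%:M.
Proof.
rewrite pmxE -scalemxAl -scalemxAr scalerA tens_mul -exprD addnn -mul2n exprM sqrCi.
congr (_ *: _); rewrite -(tens1 C n); apply: eq_tens => j a b.
by rewrite lmxM; case: (pstr P j); rewrite /= mul1r.
Qed.

Lemma sign_sq k : (-1) ^+ k * (-1) ^+ k = 1 :> C.
Proof. by rewrite -expr2 sqrr_sign. Qed.

Lemma adj_pmxM P : adj (pmx C P) *m pmx C P = 1%:M.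
Proof. by rewrite adj_pmx -scalemxAl pmx_sq scalerA sign_sq scale1r. Qed.

Lemma tr_pmx P j : ~~ is_id (pstr P j) -> \tr (pmx C P) = 0.
Proof.
move=> Pj; rewrite pmxE mxtraceZ tr_tens (bigD1 j) //= big_bool /=.
by case: (pstr P j) Pj => //= _; rewrite ?addr0 ?addNr mul0r mulr0.
Qed.

Lemma pmx_scalar P : (forall j, is_id (pstr P j)) -> pmx C P = ('i ^+ pphase P)%:M.
Proof.
move=> P1; rewrite pmxE -scalemx1 -(tens1 C n); congr (_ *: _).
by apply: eq_tens => j a b; case: (pstr P j) (P1 j).
Qed.

Lemma tr_mx1 : \tr (1%:M : 'M[C]_(2 ^ n)) = 2 ^+ n.
Proof. by rewrite mxtrace1 natrX. Qed.

Lemma tr_mx1_neq0 : \tr (1%:M : 'M[C]_(2 ^ n)) != 0.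
Proof. by rewrite tr_mx1 expf_neq0 // pnatr_eq0. Qed.

(** If the strings differed at [j], the product of [P] and [Q] would be traceless; but it equals the
    square of [P], which is plus or minus the identity. Hence the weight depends on the matrix
    alone. *)
Lemma pmx_inj_str P Q : pmx C P = pmx C Q -> pstr P =1 pstr Q.
Proof.
move=> eqPQ j; apply: lmul_id; apply: contraTT (tr_mx1_neq0) => PQj.
have := tr_pmx (P := pmul P Q) PQj; rewrite -pmxM -eqPQ pmx_sq mxtraceZ => /eqP.
by rewrite mulf_eq0 signr_eq0 negbK.
Qed.

Lemma TRmxE : TRmx C n = tens (fun _ a b => 'i * lmx C LY a b).
Proof. by []. Qed.

Lemma iY_entries a b :
  'i * lmx C LY a b = if a == b then 0 else if a then -1 else 1.
Proof.
have ii : 'i * 'i = -1 :> C by rewrite -expr2 sqrCi.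
by case: a; case: b => /=; ring: ii.
Qed.

Lemma conj_TRmx : map_mx Num.conj (TRmx C n) = TRmx C n.
Proof.
rewrite TRmxE conj_tens; apply: eq_tens => j a b; rewrite !iY_entries.
by case: a; case: b; rewrite /= ?rmorphN ?rmorph1 ?rmorph0.
Qed.

Lemma trmx_TRmx : (TRmx C n)^T = (-1) ^+ n *: TRmx C n.
Proof.
rewrite TRmxE trmx_tens.
have -> : (-1) ^+ n = \prod_(j < n) (-1) :> C by rewrite prodr_const card_ord.
rewrite -tensZ; apply: eq_tens => j a b; rewrite !iY_entries.
by case: a; case: b; rewrite /=; ring.
Qed.

Lemma TRmx_sq : TRmx C n *m TRmx C n = (-1) ^+ n *: 1%:M.
Proof.
rewrite TRmxE tens_mul.
have -> : (-1) ^+ n = \prod_(j < n) (-1) :> C by rewrite prodr_const card_ord.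
rewrite -(tens1 C n) -tensZ; apply: eq_tens => j a b.
have ii : 'i * 'i = -1 :> C by rewrite -expr2 sqrCi.
by rewrite big_bool; case: a; case: b => /=; ring: ii.
Qed.

Lemma prod_sign (p : pred 'I_n) : \prod_j (-1) ^+ p j = (-1) ^+ #|p| :> C.
Proof. by rewrite -expr_sum -sum1_card [in RHS]big_mkcond. Qed.

(** Conjugating the phase ['i ^+ k] costs [(-1) ^+ k], and each non-identity letter costs one more
    sign. *)
Lemma TRmx_pmx P :
  TRmx C n *m map_mx Num.conj (pmx C P) =
  (-1) ^+ (pphase P + pweight P) *: (pmx C P *m TRmx C n).
Proof.
rewrite TRmxE pmxE map_mxZ conj_tens -scalemxAl -scalemxAr !tens_mul /= conjXi.
rewrite (eq_tens (fun j => lmx_TR C (pstr P j))) tensZ scalerA.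
rewrite (prod_sign [pred j | ~~ is_id (pstr P j)]) scalerA exprD.
by congr (_ *: _); rewrite -/(pweight P); ring.
Qed.

End PauliOperators.

(** * Hermitian projectors of trace 1 and 2, and Kramers degeneracy *)

Section HermitianProjectors.
Variable C : numClosedFieldType.

(** Rectangular form of [adj], so that [ctm v *m w] is the inner product of column vectors. *)
Definition ctm m n (A : 'M[C]_(m, n)) : 'M[C]_(n, m) := (map_mx Num.conj A)^T.

Lemma adjE N (A : 'M[C]_N) : adj A = ctm A. Proof. by []. Qed.

Lemma ctmM m n p (A : 'M[C]_(m, n)) (B : 'M[C]_(n, p)) :
  ctm (A *m B) = ctm B *m ctm A.
Proof. by rewrite /ctm map_mxM trmx_mul. Qed.

Lemma ctmK m n : cancel (@ctm m n) (@ctm n m).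
Proof. by move=> A; apply/matrixP => i j; rewrite !mxE conjCK. Qed.

Lemma ctmD m n (A B : 'M[C]_(m, n)) : ctm (A + B) = ctm A + ctm B.
Proof. by rewrite /ctm map_mxD linearD. Qed.

Lemma ctmZ m n a (A : 'M[C]_(m, n)) : ctm (a *: A) = Num.conj a *: ctm A.
Proof. by rewrite /ctm map_mxZ linearZ. Qed.

Lemma ctm1 N : ctm (1%:M : 'M[C]_N) = 1%:M.
Proof. by rewrite /ctm map_mx1 trmx1. Qed.

Lemma tr_ctmM m n (A : 'M[C]_(m, n)) :
  \tr (ctm A *m A) = \sum_i \sum_j `|A j i| ^+ 2.
Proof.
apply: eq_bigr => i _; rewrite mxE; apply: eq_bigr => j _.
by rewrite !mxE mulrC normCK.
Qed.

Lemma tr_ctmM_ge0 m n (A : 'M[C]_(m, n)) : 0 <= \tr (ctm A *m A).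
Proof.
by rewrite tr_ctmM; apply: sumr_ge0 => i _; apply: sumr_ge0 => j _; apply: exprn_ge0.
Qed.

Lemma tr_ctmM_eq0 m n (A : 'M[C]_(m, n)) : \tr (ctm A *m A) = 0 -> A = 0.
Proof.
rewrite tr_ctmM => /eqP; rewrite psumr_eq0 => [/allP A0|i _]; last first.
  by apply: sumr_ge0 => j _; apply: exprn_ge0.
apply/matrixP => j i; rewrite mxE; move: (A0 i (mem_index_enum i)).
rewrite /= psumr_eq0 => [/allP/(_ j (mem_index_enum j))|l _]; last exact: exprn_ge0.
by rewrite /= sqrf_eq0 normr_eq0 => /eqP.
Qed.

Definition herm_proj N (P : 'M[C]_N) : Prop := ctm P = P /\ P *m P = P.

(** Since [Q] lies below [P], the difference [P - Q] is again a Hermitian projector, and its squared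
    Frobenius norm is its trace, which vanishes. *)
Lemma herm_proj_eq N (P Q : 'M[C]_N) :
  herm_proj P -> herm_proj Q -> P *m Q = Q -> \tr P = \tr Q -> P = Q.
Proof.
move=> [hP PP] [hQ QQ] PQ trPQ.
have QP : Q *m P = Q by rewrite -hQ -{1}hP -ctmM PQ.
apply/eqP; rewrite -subr_eq0; apply/eqP/tr_ctmM_eq0.
have -> : ctm (P - Q) = P - Q by rewrite -scaleN1r ctmD ctmZ hP hQ rmorphN rmorph1.
rewrite mulmxBl !mulmxBr PP QQ PQ QP subrr subr0.
by rewrite raddfB /= trPQ subrr.
Qed.

Lemma proj_unit_vector N (P : 'M[C]_N) :
  P *m P = P -> P != 0 ->
  exists2 v : 'cV[C]_N, P *m v = v & ctm v *m v = 1%:M.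
Proof.
move=> PP nzP.
have [j nzu] : exists j, col j P != 0.
  apply/existsP; apply: contraNT nzP; rewrite negb_exists => /forallP P0.
  apply/eqP/matrixP => i j; have /eqP/matrixP/(_ i 0) := negPn (P0 j).
  by rewrite !mxE.
set u := col j P in nzu; set c := (ctm u *m u) 0 0.
have cE : ctm u *m u = c%:M by rewrite [LHS]mx11_scalar.
have c_ge0 : 0 <= c by have := tr_ctmM_ge0 u; rewrite cE mxtrace_scalar.
have nzc : c != 0.
  apply: contra_neq nzu => c0; apply: tr_ctmM_eq0.
  by rewrite cE c0 mxtrace_scalar.
have Pu : P *m u = u by rewrite /u colE mulmxA PP.
exists ((sqrtC c)^-1 *: u); first by rewrite -scalemxAr Pu.
rewrite ctmZ -scalemxAl -scalemxAr cE scalerA geC0_conj ?invr_ge0 ?sqrtC_ge0 //.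
by rewrite -invfM -expr2 sqrtCK scale_scalar_mx mulVf.
Qed.

Lemma herm_proj_rank1 N (P : 'M[C]_N) :
  herm_proj P -> \tr P = 1 -> exists v : 'cV[C]_N, P = v *m ctm v.
Proof.
move=> hP trP; case: (hP) => hermP PP.
have nzP : P != 0.
  by apply: contra_eq_neq trP => ->; rewrite mxtrace0 eq_sym oner_neq0.
have [v Pv vv] := proj_unit_vector PP nzP; exists v.
apply: herm_proj_eq => //; last 1 first.
- by rewrite trP mxtrace_mulC vv mxtrace1.
- by split; rewrite ?ctmM ?ctmK // mulmxA -(mulmxA v) vv mulmx1.
by rewrite mulmxA Pv.
Qed.

(** With [P = v v^*], one has [M P = P M P = (v^* M v) P]. *)
Lemma rank1_scalar N (P : 'M[C]_N) : herm_proj P -> \tr P = 1 ->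
  forall M, M *m P = P *m M -> exists c, M *m P = c *: P.
Proof.
move=> hP /(herm_proj_rank1 hP)[v Pv] M MP.
exists ((ctm v *m M *m v) 0 0); case: hP => _ PP.
rewrite -{1}PP mulmxA MP Pv -!mulmxA 2!(mulmxA (ctm v)) (mulmxA _ v).
by rewrite [in LHS](mx11_scalar (ctm v *m M *m v)) mul_scalar_mx -scalemxAr.
Qed.

Lemma neq_opp N (P : 'M[C]_N) : P = - P -> P = 0.
Proof.
move=> /eqP; rewrite -addr_eq0 -mulr2n -scaler_nat scaler_eq0 pnatr_eq0 /=.
by move/eqP.
Qed.

(* The eigenvalue 1 part of [X] in the range of [P] is a line ([B] makes [X] traceless),
   so [Z] and [A], which preserve it, commute there. *)
Lemma two_anticommuting_pairs N (P X Z A B : 'M[C]_N) :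
  herm_proj P -> \tr P = 2 ->
  ctm X = X -> X *m X = 1%:M -> B *m ctm B = 1%:M -> Z *m Z = 1%:M ->
  ctm A *m A = 1%:M ->
  X *m P = P *m X -> Z *m P = P *m Z -> A *m P = P *m A -> B *m P = P *m B ->
  X *m B = - (B *m X) -> Z *m A = - (A *m Z) ->
  Z *m X = X *m Z -> A *m X = X *m A -> False.
Proof.
move=> [hP PP] trP hX XX BB ZZ AA XP ZP AP BP XB ZA ZX AX.
have n2 : 2 != 0 :> C by rewrite pnatr_eq0.
(* Conjugation by the unitary [B] fixes [P] and negates [X], so this trace is its own opposite. *)
have trPX : \tr (P *m X) = 0.
  have : \tr (P *m X) = - \tr (P *m X).
    rewrite -{1}[X]mulmx1 -BB (mulmxA X) XB mulNmx mulmxN raddfN /=; congr (- _).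
    by rewrite !mulmxA -BP mxtrace_mulC !mulmxA (mulmx1C BB) mul1mx.
  by move=> /eqP; rewrite -addr_eq0 -mulr2n -mulr_natl mulf_eq0 (negPf n2) => /eqP.
(* The projector onto the eigenvalue 1 part of [X] in the range of [P]; it has trace 1 because [P X]
   is traceless. *)
set Q : 'M[C]_N := 2^-1 *: (P *m (1%:M + X)).
have QC M : M *m P = P *m M -> M *m X = X *m M -> M *m Q = Q *m M.
  move=> MP MX; rewrite /Q -scalemxAr -scalemxAl mulmxA MP -!mulmxA; congr (_ *: (_ *m _)).
  by rewrite mulmxDl mulmxDr MX mulmx1 mul1mx.
have X1P : (1%:M + X) *m P = P *m (1%:M + X).
  by rewrite mulmxDl mulmxDr mul1mx mulmx1 XP.
have X1X1 : (1%:M + X) *m (1%:M + X) = 2 *: (1%:M + X).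
  by rewrite mulmxDl !mulmxDr !mul1mx mulmx1 XX (addrC X) -mulr2n -scaler_nat.
have hQ : herm_proj Q.
  split; first by rewrite /Q ctmZ ctmM ctmD ctm1 hX hP fmorphV rmorph_nat X1P.
  rewrite /Q -scalemxAl -scalemxAr -mulmxA (mulmxA _ P) X1P -!mulmxA X1X1.
  by rewrite -!scalemxAr mulmxA PP (scalerA _ 2) mulVf // scale1r.
have trQ : \tr Q = 1.
  by rewrite /Q mxtraceZ mulmxDr raddfD /= mulmx1 trPX addr0 trP mulVf.
clearbody Q.
have [c Zc] := rank1_scalar hQ trQ (QC Z ZP ZX).
have [d Ad] := rank1_scalar hQ trQ (QC A AP AX).
have nzQ : Q != 0 by apply: contra_eq_neq trQ => ->; rewrite mxtrace0 eq_sym oner_neq0.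
have nz_scalar M M' e : M' *m M = 1%:M -> M *m Q = e *: Q -> e != 0.
  move=> M'M MQ; apply: contra_neq nzQ => e0.
  by rewrite -[Q]mul1mx -M'M -mulmxA MQ e0 scale0r mulmx0.
(* On the line, [Z] and [A] act by nonzero scalars [c] and [d], and anticommutation forces
   [c d = - c d]. *)
have : Z *m A *m Q = - (A *m Z *m Q) by rewrite ZA mulNmx.
rewrite -!mulmxA Ad Zc -!scalemxAr Ad Zc !scalerA mulrC => /neq_opp/eqP.
by rewrite !scaler_eq0 mulf_eq0 (negPf nzQ) (negPf (nz_scalar _ _ _ ZZ Zc))
  (negPf (nz_scalar _ _ _ AA Ad)).
Qed.

(* Kramers degeneracy: an antisymmetric [J] makes [v] and [J v^*] orthogonal,
   and the time-reversal symmetry of [A] makes them degenerate. *)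
Lemma kramers_scalar N (J P A : 'M[C]_N) :
  map_mx Num.conj J = J -> J^T = - J -> J *m J = - 1%:M ->
  herm_proj P -> \tr P = 2 -> J *m map_mx Num.conj P = P *m J ->
  ctm A = A -> P *m A *m P = A -> J *m map_mx Num.conj A = A *m J ->
  A = (\tr A / 2) *: P.
Proof.
move=> Jr Ja JJ hP trP JP hA PAP JA; case: (hP) => hermP PP.
have n2 : 2 != 0 :> C by rewrite pnatr_eq0.
have nzP : P != 0.
  by apply: contra_eq_neq trP => ->; rewrite mxtrace0 eq_sym.
have [v Pv vv] := proj_unit_vector PP nzP.
set w := J *m map_mx Num.conj v.
have hJ : ctm J = - J by rewrite /ctm Jr.
(* This 1 by 1 matrix equals its transpose, which antisymmetry of [M] turns into its opposite. *)
have skew0 (M : 'M[C]_N) : M^T = - M -> ctm v *m (M *m map_mx Num.conj v) = 0.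
  move=> Ma; apply: neq_opp; set x := _ *m _.
  have {1}-> : x = x^T by rewrite (mx11_scalar x) tr_scalar_mx.
  by rewrite /x !trmx_mul trmxK Ma mulmxN mulNmx -mulmxA.
have cv : ctm (map_mx Num.conj v) = v^T by apply/matrixP => i j; rewrite !mxE conjCK.
have Pw : P *m w = w by rewrite mulmxA -JP -mulmxA -map_mxM Pv.
have vw : ctm v *m w = 0 by apply: skew0.
have wv : ctm w *m v = 0 by rewrite -[v in _ *m v]ctmK -ctmM vw /ctm map_mx0 trmx0.
(* A time-reversal invariant Hermitian [M] has the same expectation at [w] as at [v]. Taking [M = 1]
   normalizes [w], and [M = A] gives the degeneracy. *)
have wE (M : 'M[C]_N) : ctm M = M -> J *m map_mx Num.conj M = M *m J ->
    ctm w *m (M *m w) = (ctm v *m (M *m v))^T.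
  move=> hM JM; have cM : map_mx Num.conj M = M^T by rewrite -{2}hM trmxK.
  rewrite ctmM hJ mulmxN mulNmx (mulmxA M) -JM -!mulmxA (mulmxA J J).
  rewrite JJ mulNmx mulmxN opprK mul1mx !trmx_mul -mulmxA cM.
  by rewrite cv /ctm trmxK.
have ww : ctm w *m w = 1%:M.
  have := wE 1%:M; rewrite ctm1 map_mx1 !mul1mx mulmx1 vv trmx1.
  exact.
have wJ : w = J *m map_mx Num.conj v by [].
clearbody w.
(* [v] and [w] are orthonormal in the range of [P], and trace 2 leaves room for no other
   direction. *)
have PE : P = v *m ctm v + w *m ctm w.
  apply: herm_proj_eq => //; last 1 first.
  - by rewrite raddfD /= !(mxtrace_mulC _ (ctm _)) vv ww mxtrace1 trP.
  - split; first by rewrite ctmD !ctmM !ctmK.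
    rewrite mulmxDl !mulmxDr -!mulmxA !(mulmxA (ctm v)) !(mulmxA (ctm w)) vv ww vw wv.
    by rewrite !mul1mx !mul0mx !mulmx0 addr0 add0r.
  by rewrite mulmxDr !mulmxA Pv Pw.
pose a := (ctm v *m (A *m v)) 0 0.
have vAv : ctm v *m (A *m v) = a%:M by rewrite [LHS]mx11_scalar.
(* [A J] is antisymmetric: [A^T] is the conjugate of [A], so the transpose of [A J] is
   [- J conj(A) = - A J]. *)
have vAw : ctm v *m (A *m w) = 0.
  rewrite wJ (mulmxA A); apply: skew0.
  by rewrite trmx_mul Ja mulNmx -JA -[A in A^T]hA /ctm trmxK.
have wAv : ctm w *m (A *m v) = 0.
  have -> : ctm w *m (A *m v) = ctm (ctm v *m (A *m w)) by rewrite !ctmM hA ctmK -mulmxA.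
  by rewrite vAw /ctm map_mx0 trmx0.
have wAw : ctm w *m (A *m w) = a%:M by rewrite wE // vAv tr_scalar_mx.
have PA : P *m A = A by rewrite -PAP !mulmxA PP.
have AP : A *m P = A by rewrite -PAP -!mulmxA PP.
have Av : A *m v = a *: v.
  rewrite -PA PE mulmxDl mulmxDl -!mulmxA vAv wAv mulmx0 addr0.
  by rewrite mul_mx_scalar.
have Aw : A *m w = a *: w.
  rewrite -PA PE mulmxDl mulmxDl -!mulmxA vAw wAw mulmx0 add0r.
  by rewrite mul_mx_scalar.
have AE : A = a *: P.
  by rewrite -AP {1}PE mulmxDr !mulmxA Av Aw -!scalemxAl -scalerDr -PE.
by rewrite {2}AE mxtraceZ trP mulfK.
Qed.
End HermitianProjectors.

(** * Closure properties of generated sets of matrices *)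

Section GeneratedGroup.
Variables (C : numClosedFieldType) (N k : nat) (gs : 'I_k -> 'M[C]_N).
Implicit Types (p q : pred 'I_k) (A B M : 'M[C]_N).

Lemma gen_in_mul p A B : gen_in p gs A -> gen_in p gs B -> gen_in p gs (A *m B).
Proof.
move=> gA gB; elim: gA => [|i M pi _ IH]; first by rewrite mul1mx.
by rewrite -mulmxA; apply: gen_mul.
Qed.

Lemma gen_in_gen p i : p i -> gen_in p gs (gs i).
Proof. by move=> pi; rewrite -[gs i]mulmx1; apply: gen_mul => //; apply: gen_one. Qed.

Lemma gen_in_sub p q M : subpred p q -> gen_in p gs M -> gen_in q gs M.
Proof.
move=> pq; elim=> [|i A pi _ IH]; first exact: gen_one.
by apply: gen_mul => //; apply: pq.
Qed.

Lemma gen_in_comm p A M :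
  (forall i, A *m gs i = gs i *m A) -> gen_in p gs M -> A *m M = M *m A.
Proof.
move=> Ags; elim=> [|i B _ _ IH]; first by rewrite mulmx1 mul1mx.
by rewrite mulmxA Ags -!mulmxA IH.
Qed.

End GeneratedGroup.

(** * Ordered products of matrices *)

Section MatrixProducts.
Variables (C : numClosedFieldType) (N : nat) (I : Type).
Implicit Types (e : I -> 'M[C]_N) (r : seq I).

Lemma bigmx_comm e r A :
  (forall i, A *m e i = e i *m A) ->
  A *m \big[mulmx/1%:M]_(i <- r) e i = \big[mulmx/1%:M]_(i <- r) e i *m A.
Proof.
move=> Ae; elim/big_ind: _ => [|B D BA DA|i _]; rewrite ?mulmx1 ?mul1mx //.
by rewrite mulmxA BA -!mulmxA DA.
Qed.

Lemma bigmx_herm_proj e r :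
  (forall i, herm_proj (e i)) -> (forall i j, e i *m e j = e j *m e i) ->
  herm_proj (\big[mulmx/1%:M]_(i <- r) e i).
Proof.
move=> he ee; elim: r => [|i r [hP PP]]; first by rewrite big_nil; split; rewrite ?ctm1 ?mulmx1.
rewrite big_cons; have [hei ei2] := he i; have comm := bigmx_comm r (ee i); split.
  by rewrite ctmM hP hei comm.
by rewrite {2}comm mulmxA -(mulmxA (e i)) PP -mulmxA -comm mulmxA ei2.
Qed.

Lemma bigmx_conj e r J :
  (forall i, J *m map_mx Num.conj (e i) = e i *m J) ->
  J *m map_mx Num.conj (\big[mulmx/1%:M]_(i <- r) e i) =
  \big[mulmx/1%:M]_(i <- r) e i *m J.
Proof.
move=> Je; elim/big_ind: _ => [|B D BJ DJ|i _]; rewrite ?map_mx1 ?mulmx1 ?mul1mx //.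
by rewrite map_mxM mulmxA BJ -!mulmxA DJ.
Qed.

End MatrixProducts.

(** * Syndrome projectors of commuting Hermitian involutions *)

Section SyndromeProjectors.
Variables (C : numClosedFieldType) (N k : nat) (G : 'I_k -> 'M[C]_N).
Hypothesis hermG : forall i, ctm (G i) = G i.
Hypothesis G_sq : forall i, G i *m G i = 1%:M.
Hypothesis G_comm : forall i j, G i *m G j = G j *m G i.

Definition synd_factor (b : bool) i : 'M[C]_N :=
  2^-1 *: (1%:M + (if b then -1 else 1) *: G i).

Definition synd_prod (s : syndrome k) : 'M[C]_N :=
  \big[mulmx/1%:M]_(i < k) synd_factor (s i) i.

Lemma synd_factor_comm A b i : A *m G i = G i *m A ->
  A *m synd_factor b i = synd_factor b i *m A.
Proof.
move=> AG; rewrite /synd_factor -scalemxAr -scalemxAl mulmxDr mulmxDl.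
by rewrite mulmx1 mul1mx -scalemxAr -scalemxAl AG.
Qed.

Lemma synd_prod_comm s A : (forall i, A *m G i = G i *m A) ->
  A *m synd_prod s = synd_prod s *m A.
Proof. by move=> AG; apply: bigmx_comm => i; apply: synd_factor_comm. Qed.

Lemma synd_factor_herm_proj b i : herm_proj (synd_factor b i).
Proof.
have cj : Num.conj (if b then -1 else 1) = (if b then -1 else 1) :> C.
  by case: (b); rewrite ?rmorphN rmorph1.
split; first by rewrite /synd_factor ctmZ ctmD ctmZ ctm1 hermG cj fmorphV rmorph_nat.
rewrite /synd_factor -scalemxAr -scalemxAl mulmxDl !mulmxDr !mul1mx mulmx1.
rewrite -scalemxAl -scalemxAr G_sq (scalerA (if b then -1 else 1)).
have -> : (if b then -1 else 1) * (if b then -1 else 1) = 1 :> C.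
  by case: (b); rewrite ?mulrNN mulr1.
rewrite scale1r (addrC _ 1%:M) -mulr2n -scaler_nat (scalerA _ 2) mulVf ?scale1r //.
by rewrite pnatr_eq0.
Qed.

Lemma synd_prod_herm_proj s : herm_proj (synd_prod s).
Proof.
apply: bigmx_herm_proj => [i|i j]; first exact: synd_factor_herm_proj.
by apply: synd_factor_comm; apply/esym/synd_factor_comm.
Qed.

Lemma synd_prod_conj s J :
  (forall i, J *m map_mx Num.conj (G i) = G i *m J) ->
  J *m map_mx Num.conj (synd_prod s) = synd_prod s *m J.
Proof.
move=> JG; apply: bigmx_conj => i; rewrite /synd_factor.
rewrite map_mxZ map_mxD map_mx1 map_mxZ -scalemxAr -scalemxAl mulmxDr mulmxDl.
rewrite mulmx1 mul1mx -scalemxAr -scalemxAl JG /= fmorphV rmorph_nat.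
by case: (s i); rewrite ?rmorphN rmorph1.
Qed.

(** For each generator the two factors sum to the identity; expanding the product of these sums
    yields one term per syndrome. *)
Lemma sum_synd_prod : \sum_s synd_prod s = 1%:M.
Proof.
have := bigA_distr_bigA (times := *%R) (plus := +%R)
  (fun i b => synd_factor b i : 'M[C]_N).
rewrite -/(synd_prod _) => <-; apply: big1 => i _.
rewrite big_bool /synd_factor /= -scalerDr scaleN1r scale1r addrACA addNr addr0.
by rewrite -mulr2n -scaler_nat scalerA mulVf ?scale1r // pnatr_eq0.
Qed.

(** When the product is expanded, only the term choosing the identity in every factor has a
    trace. *)
Lemma tr_synd_prod0 :
  (forall i M, gen_in (predC1 i) G M -> \tr (M *m G i) = 0) ->
  \tr (synd_prod (synd0 k)) = 2^-1 ^+ k * \tr (1%:M : 'M[C]_N).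
Proof.
move=> indep.
(* [M] collects the generators chosen from factors already expanded, all outside [r]. Each further
   factor splits the trace in two, and the half containing [G i] vanishes by independence. *)
suff gen (r : seq 'I_k) : uniq r -> forall M, gen_in [predC r] G M ->
    \tr (\big[mulmx/1%:M]_(i <- r) synd_factor false i *m M) = 2^-1 ^+ size r * \tr M.
  have sz : size (index_enum 'I_k) = k by rewrite [index_enum _]unlock -enumT size_enum_ord.
  have := gen _ (index_enum_uniq 'I_k) _ (gen_one _ _); rewrite sz mulmx1 => <-.
  by congr (\tr _); apply: eq_bigr => i _; rewrite ffunE.
elim: r => [_ M _|i r IH /= /andP[ir ur] M gM]; first by rewrite big_nil mul1mx mul1r.
have gMr : gen_in [predC r] G M.
  by apply: gen_in_sub gM => j; rewrite !inE negb_or => /andP[].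
rewrite big_cons {1}/synd_factor scale1r -2!scalemxAl mxtraceZ exprS -mulrA.
congr (_ * _); rewrite mulmxDl mul1mx mulmxDl raddfD /= IH //.
rewrite -mulmxA mxtrace_mulC -mulmxA IH //; last first.
  by apply: gen_in_mul => //; apply: gen_in_gen.
rewrite indep ?mulr0 ?addr0 //.
by apply: gen_in_sub gM => j; rewrite !inE negb_or => /andP[].
Qed.

End SyndromeProjectors.

(** * The stabilizer group, the dimension of the code, and the parity of [n] *)

Section Stabilizer.
Variables (C : numClosedFieldType) (n k : nat) (g : 'I_k -> pauli n).
Implicit Types (P : pauli n) (l : letter).

Definition gmx i := pmx C (g i).

Definition uniform_pauli l : pauli n := Pauli 0 (fun _ => l).

Lemma scalar_pmx m : ('i ^+ m)%:M = pmx C (Pauli m (fun _ : 'I_n => LI)).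
Proof. by rewrite pmx_scalar. Qed.

Lemma gen_in_pauli (p : pred 'I_k) M : gen_in p gmx M -> exists P, M = pmx C P.
Proof.
elim=> [|i A _ _ [P ->]]; first by rewrite -[1]/('i ^+ 0) scalar_pmx; eexists.
by rewrite /gmx pmxM; eexists.
Qed.

Lemma uniform_pauli_comm l P :
  (forall q, lanti l (pstr P q) = false) ->
  pmx C (uniform_pauli l) *m pmx C P = pmx C P *m pmx C (uniform_pauli l).
Proof.
by move=> lP; rewrite pmx_comm big1 ?scale1r // => q _; rewrite /= lP.
Qed.

Lemma uniform_pauli_sign l P :
  (forall q, lanti l (pstr P q) = ~~ is_id (pstr P q)) ->
  pmx C (uniform_pauli l) *m pmx C P =
  (-1) ^+ pweight P *: (pmx C P *m pmx C (uniform_pauli l)).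
Proof.
move=> lP; rewrite pmx_comm -(prod_sign C [pred j | ~~ is_id (pstr P j)]).
by congr (_ *: _); apply: eq_bigr => q _; rewrite /= lP.
Qed.

Hypothesis stab_g : stabilizer_generators C g.

Lemma stab_no_opp1 : ~ stab_group g (- 1%:M : 'M[C]_(2 ^ n)).
Proof. by case: stab_g. Qed.

(** An element with an odd phase squares to [-1], which the group does not contain. *)
Lemma stab_phase P : stab_group g (pmx C P) -> ~~ odd (pphase P).
Proof.
move=> gP; apply/negP => oddP; apply: stab_no_opp1.
have := gen_in_mul gP gP; rewrite pmx_sq -signr_odd oddP expr1 scaleN1r.
exact.
Qed.

Lemma stab_sq P : stab_group g (pmx C P) -> pmx C P *m pmx C P = 1%:M.
Proof. by move=> /stab_phase; rewrite pmx_sq -signr_odd => /negPf ->; rewrite scale1r. Qed.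

Lemma stab_herm P : stab_group g (pmx C P) -> ctm (pmx C P) = pmx C P.
Proof.
move=> /stab_phase; rewrite -adjE adj_pmx -signr_odd => /negPf ->.
by rewrite scale1r.
Qed.

Lemma stab_gen i : stab_group g (gmx i).
Proof. exact: gen_in_gen. Qed.

Lemma stab_scalar m : stab_group g (('i ^+ m)%:M : 'M[C]_(2 ^ n)) -> 'i ^+ m = 1 :> C.
Proof.
move=> gm; have := gm; rewrite scalar_pmx => /stab_phase /= even_m.
move: gm; rewrite -(odd_double_half m) (negPf even_m) -mul2n exprM sqrCi.
rewrite -signr_odd; case: odd; rewrite ?expr0 // expr1 -scalemx1 scaleN1r.
by move/stab_no_opp1.
Qed.

(** Otherwise the Pauli string of [M g_i] is the identity, so [M g_i] is a scalar in the stabilizer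
    group, hence 1. As [g_i] squares to 1, it equals [M], against minimality of the generators. *)
Lemma tr_independent i M : gen_in (predC1 i) gmx M -> \tr (M *m gmx i) = 0.
Proof.
move=> gM; have [P MP] := gen_in_pauli gM.
case: (boolP [forall q, is_id (pstr (pmul P (g i)) q)]) => [/forallP idq|]; last first.
  by rewrite negb_forall => /existsP[q /tr_pmx <-]; rewrite MP pmxM.
have Mgi : M *m gmx i = ('i ^+ pphase (pmul P (g i)))%:M by rewrite MP pmxM pmx_scalar.
have gMgi : stab_group g (M *m gmx i).
  by apply: gen_in_mul (stab_gen i); apply: gen_in_sub gM.
move: gMgi; rewrite Mgi => /stab_scalar eq1.
case: stab_g => _ _ /(_ i); case; rewrite -/(gmx i).
suff -> : gmx i = M by [].
by rewrite -[M]mulmx1 -(stab_sq (stab_gen i)) mulmxA Mgi eq1 mul1mx.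
Qed.

Lemma tr_code_proj : \tr (code_proj C g) = 2^-1 ^+ k * 2 ^+ n.
Proof. by rewrite -tr_mx1 -(tr_synd_prod0 tr_independent). Qed.

Lemma synd_proj_herm_proj s : herm_proj (synd_proj C g s).
Proof.
apply: synd_prod_herm_proj => [i|i|].
- exact/stab_herm/stab_gen.
- exact/stab_sq/stab_gen.
- by case: stab_g.
Qed.

Hypothesis even_g : forall M, stab_group g M ->
  exists P : pauli n, pmx C P = M /\ ~~ odd (pweight P).

Lemma stab_TRmx M : stab_group g M ->
  TRmx C n *m map_mx Num.conj M = M *m TRmx C n.
Proof.
move=> gM; have [P [MP even_P]] := even_g gM.
move: gM; rewrite -MP => /stab_phase even_ph.
by rewrite TRmx_pmx -signr_odd oddD (negPf even_P) (negPf even_ph) scale1r.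
Qed.

Lemma synd_proj_TRmx s :
  TRmx C n *m map_mx Num.conj (synd_proj C g s) = synd_proj C g s *m TRmx C n.
Proof. by apply: synd_prod_conj => i; apply/stab_TRmx/stab_gen. Qed.

Lemma stab_even_weight P : stab_group g (pmx C P) -> ~~ odd (pweight P).
Proof.
move=> /even_g[Q [/pmx_inj_str eqQP]]; congr (~~ odd _).
by apply: eq_card => q; rewrite !inE eqQP.
Qed.

(** It suffices to commute with the CSS generators [h j]. Those of the same type commute letter by
    letter; the others contribute the sign of their weight, which is even. *)
Lemma css_uniform_comm l i : is_CSS C g -> l = LX \/ l = LZ ->
  pmx C (uniform_pauli l) *m gmx i = gmx i *m pmx C (uniform_pauli l).
Proof.
move=> [m [h [typ_h gh]]] lXZ; have /gh := stab_gen i; apply: gen_in_comm => j.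
have even_h : ~~ odd (pweight (h j)) by apply/stab_even_weight/gh/gen_in_gen.
have sgn1 : (-1) ^+ pweight (h j) = 1 :> C by rewrite -signr_odd (negPf even_h).
case: lXZ (typ_h j) => -> [] typ.
- by apply: uniform_pauli_comm => q; case: (pstr _ q) (typ q).
- rewrite uniform_pauli_sign ?sgn1 ?scale1r // => q.
  by case: (pstr _ q) (typ q).
- rewrite uniform_pauli_sign ?sgn1 ?scale1r // => q.
  by case: (pstr _ q) (typ q).
- by apply: uniform_pauli_comm => q; case: (pstr _ q) (typ q).
Qed.

Lemma odd_qubits (xl zl : pauli n) :
  is_CSS C g -> \tr (code_proj C g) = 2 ->
  (forall q, is_xl (pstr xl q)) -> (forall q, is_zl (pstr zl q)) ->
  (forall i, gmx i *m pmx C xl = pmx C xl *m gmx i) ->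
  (forall i, gmx i *m pmx C zl = pmx C zl *m gmx i) ->
  odd (pweight xl) -> odd (pweight zl) -> odd n.
Proof.
move=> css tr2 typ_xl typ_zl xl_comm zl_comm odd_xl odd_zl; apply/negPn/negP => even_n.
have herm l : ctm (pmx C (uniform_pauli l)) = pmx C (uniform_pauli l).
  by rewrite -adjE adj_pmx scale1r.
have sq l : pmx C (uniform_pauli l) *m pmx C (uniform_pauli l) = 1%:M.
  by rewrite pmx_sq scale1r.
have comm A : (forall i, gmx i *m A = A *m gmx i) ->
    A *m code_proj C g = code_proj C g *m A.
  by move=> Ag; apply: synd_prod_comm => i; rewrite -Ag.
have wX : pweight (uniform_pauli LX) = n by rewrite /pweight -[RHS]card_ord; apply: eq_card.
(* The anticommuting pairs are [X^n] with [zl] and [Z^n] with [xl]; evenness of [n] makes [X^n] and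
   [Z^n] commute. *)
apply: (@two_anticommuting_pairs C _ (code_proj C g) (pmx C (uniform_pauli LX))
  (pmx C (uniform_pauli LZ)) (pmx C xl) (pmx C zl)) => //.
- exact: synd_proj_herm_proj.
- exact/mulmx1C/adj_pmxM.
- exact: adj_pmxM.
- by apply: comm => i; rewrite css_uniform_comm //; left.
- by apply: comm => i; rewrite css_uniform_comm //; right.
- exact: comm.
- exact: comm.
- rewrite uniform_pauli_sign => [|q]; last by case: (pstr _ q) (typ_zl q).
  by rewrite -signr_odd odd_zl expr1 scaleN1r.
- rewrite uniform_pauli_sign => [|q]; last by case: (pstr _ q) (typ_xl q).
  by rewrite -signr_odd odd_xl expr1 scaleN1r.
- rewrite uniform_pauli_sign // wX.
  by rewrite -signr_odd (negPf even_n) scale1r.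
- by rewrite uniform_pauli_comm // => q; case: (pstr _ q) (typ_xl q).
Qed.

End Stabilizer.

(** * From scalar [K^* K] to unitaries of the code space *)

Section Assembly.
Variables (C : numClosedFieldType) (N : nat).

Lemma scaled_partial_isometry (P K : 'M[C]_N) r :
  herm_proj P -> P *m K = K -> K *m P = K ->
  Num.conj r = r -> ctm K *m K = (r * r) *: P ->
  exists L, [/\ P *m L *m P = L, ctm L *m L = P & L *m ctm L = P]
    /\ K = r *: (L *m P).
Proof.
move=> hP PK KP rr KK; case: (hP) => hermP PP.
have [r0|nzr] := eqVneq r 0.
  (* Here [K = 0], so any unitary of the code space serves; [P] is its identity. *)
  exists P; rewrite hermP !PP r0 scale0r; split=> //.
  by apply: tr_ctmM_eq0; rewrite KK r0 mul0r scale0r mxtrace0.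
have crV : Num.conj r^-1 = r^-1 by rewrite fmorphV /= rr.
set L := r^-1 *: K.
have LL : ctm L *m L = P.
  rewrite /L ctmZ crV -scalemxAl -scalemxAr KK !scalerA.
  by rewrite mulrA mulfVK // mulVf // scale1r.
have LP : L *m P = L by rewrite /L -scalemxAl KP.
have PL : P *m L = L by rewrite /L -scalemxAr PK.
exists L; split; last by rewrite LP /L scalerA divff // scale1r.
split=> //; first by rewrite PL LP.
(* [L L^*] is a projector below [P], with the trace of [L^* L = P]. *)
apply/esym/herm_proj_eq => //; first split.
- by rewrite ctmM ctmK.
- by rewrite mulmxA -(mulmxA L) LL LP.
- by rewrite mulmxA PL.
- by rewrite mxtrace_mulC LL.
Qed.

Lemma conj_commM (J A B : 'M[C]_N) :
  J *m map_mx Num.conj A = A *m J -> J *m map_mx Num.conj B = B *m J ->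
  J *m map_mx Num.conj (A *m B) = A *m B *m J.
Proof. by move=> JA JB; rewrite map_mxM mulmxA JA -mulmxA JB mulmxA. Qed.

Lemma conj_comm_inv (J U V : 'M[C]_N) : U *m V = 1%:M ->
  J *m map_mx Num.conj U = U *m J -> J *m map_mx Num.conj V = V *m J.
Proof.
move=> UV JU; rewrite -[LHS]mul1mx -(mulmx1C UV) -!mulmxA (mulmxA U) -JU.
by rewrite -mulmxA -map_mxM UV map_mx1 mulmx1.
Qed.

End Assembly.

(** As [TRmx] is real, the antiunitary sends [psi] to [TRmx conj(psi)]; testing the commutation on
    basis vectors gives a linear matrix identity. *)
Lemma commutes_with_TR_conj (C : numClosedFieldType) n (U : 'M[C]_(2 ^ n)) :
  commutes_with_TR U -> TRmx C n *m map_mx Num.conj U = U *m TRmx C n.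
Proof.
move=> UT; apply/matrixP => i j.
have := UT (map_mx Num.conj (delta_mx j 0)); rewrite /time_reversal.
rewrite !map_mxM conj_TRmx; set d := map_mx _ (map_mx _ _).
have -> : d = delta_mx j 0 by apply/matrixP => a b; rewrite !mxE /= conjCK.
by rewrite !mulmxA -!colE => /matrixP/(_ i 0); rewrite !mxE.
Qed.

(** Take adjoints: a Pauli operator is its own adjoint up to a sign, which cancels. Applied to a
    recovery operation, this shows that it carries the syndrome space back into the code space. *)
Lemma recovery_swap (C : numClosedFieldType) n (Q : pauli n) (A B : 'M[C]_(2 ^ n)) :
  ctm A = A -> ctm B = B ->
  A *m pmx C Q = pmx C Q *m B -> pmx C Q *m A = B *m pmx C Q.
Proof.
move=> hA hB /(congr1 (@ctm C _ _)); rewrite !ctmM hA hB -adjE adj_pmx.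
rewrite -scalemxAl -scalemxAr => /(congr1 (fun M => (-1) ^+ pphase Q *: M)).
by rewrite !scalerA sign_sq !scale1r.
Qed.

Theorem theorem1 (R : realType) (n : nat)
  (g : 'I_(n - 1) -> pauli n)
  (Crec : syndrome (n - 1) -> pauli n)
  (U : 'M[R[i]]_(2 ^ n)) :
  (0 < n)%N ->
  stabilizer_generators R[i] g ->
  (forall s, synd_proj R[i] g s *m pmx R[i] (Crec s)
             = pmx R[i] (Crec s) *m code_proj R[i] g) ->
  unitary U ->
  (forall M, stab_group g M ->
     exists P : pauli n, pmx R[i] P = M /\ ~~ odd (pweight P)) ->
  is_CSS R[i] g ->
  (exists dx dz : nat, [/\ odd dx, odd dz,
      is_type_distance R[i] is_xl g dx & is_type_distance R[i] is_zl g dz]) ->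
  commutes_with_TR U ->
  exists p : syndrome (n - 1) -> R,
    [/\ forall s, 0 <= p s,
        \sum_s p s = 1
      & forall s, exists UL : 'M[R[i]]_(2 ^ n),
          logical_unitary g UL /\
          pmx R[i] (Crec s) *m synd_proj R[i] g s *m U *m code_proj R[i] g
            = (Num.sqrt (p s))%:C *: (UL *m code_proj R[i] g)].
Proof.
move=> n_gt0 stab_g recP [UU U'U] even_g css [dx [dz [odd_dx odd_dz]]] [].
move=> [xl [typ_xl [[xl_comm _] wx]]] _ [[zl [typ_zl [[zl_comm _] wz]]] _] UT.
(* The [n - 1] independent generators each halve [2 ^ n]; [0 < n] keeps the subtraction from
   truncating. *)
have trP : \tr (code_proj R[i] g) = 2.
  rewrite tr_code_proj // -{2}(subnK n_gt0) addn1 exprSr mulrA -exprMn mulVf.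
    by rewrite expr1n mul1r.
  by rewrite pnatr_eq0.
have odd_n : odd n.
  by apply: (odd_qubits stab_g even_g css trP typ_xl typ_zl); rewrite ?wx ?wz.
have hS := synd_proj_herm_proj stab_g; have JS := synd_proj_TRmx stab_g even_g.
have sumS : \sum_s synd_proj R[i] g s = 1%:M by apply: sum_synd_prod.
have hP := hS (synd0 _); have JP := JS (synd0 _).
rewrite /logical_unitary -/(code_proj _ _) in hP JP *.
(* Opaque names keep [mulmxA] from unfolding the projectors. *)
move: (synd_proj R[i] g) (code_proj R[i] g) => S P in recP trP hS JS sumS hP JP *.
case: (hP) => hermP PP.
pose K s := pmx R[i] (Crec s) *m S s *m U *m P.
pose A s := ctm (K s) *m K s.
have hermS s : ctm (S s) = S s by case: (hS s).
have SS s : S s *m S s = S s by case: (hS s).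
have KP s : K s *m P = K s by rewrite /K -!mulmxA PP.
have PK s : P *m K s = K s.
  by rewrite /K (recovery_swap (hermS s) hermP (recP s)) !mulmxA PP.
(* The recovery operation is unitary and cancels, so [A s] does not depend on its choice. *)
have AE s : A s = P *m (ctm U *m S s *m U) *m P.
  rewrite /A /K !ctmM hermS hermP -!mulmxA (mulmxA (ctm (pmx _ _))).
  by rewrite -adjE adj_pmxM mul1mx (mulmxA (S s)) SS.
have JU := commutes_with_TR_conj UT.
have A_scalar s : A s = (\tr (A s) / 2) *: P.
  have sgn : (-1) ^+ n = -1 :> R[i] by rewrite -signr_odd odd_n.
  apply: (kramers_scalar (J := TRmx R[i] n)) => //.
  - exact: conj_TRmx.
  - by rewrite trmx_TRmx sgn scaleN1r.
  - by rewrite TRmx_sq sgn scaleN1r.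
  - by rewrite ctmM ctmK.
  - by rewrite AE !mulmxA PP -!mulmxA PP.
  (* Each factor of [A s] commutes with time reversal; [ctm U] inherits this as the inverse of
     [U]. *)
  - rewrite AE; do 2?[apply: conj_commM => //].
    apply: conj_commM => //; apply: conj_commM; last exact: JS.
    exact: conj_comm_inv UU JU.
(* The Kramers scalar is nonnegative, hence real, so taking the real part loses nothing. *)
pose p s : R := complex.Re (\tr (A s) / 2).
have trA_ge0 s : 0 <= \tr (A s) / 2 by rewrite divr_ge0 ?tr_ctmM_ge0 ?ler0n.
have trAE s : \tr (A s) / 2 = (p s)%:C by rewrite RRe_real ?ger0_real.
have p_ge0 s : 0 <= p s by rewrite -ler0c -trAE.
exists p; split=> // [|s].
  (* The syndrome projectors sum to 1 and [U] is unitary, so the [A s] sum to [P], of trace 2. *)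
  have : \sum_s \tr (A s) / 2 = 1.
    rewrite -mulr_suml -raddf_sum /=.
    under eq_bigr => s _ do rewrite AE.
    rewrite -mulmx_suml -mulmx_sumr -mulmx_suml -mulmx_sumr sumS.
    by rewrite mulmx1 U'U mulmx1 PP trP divff // pnatr_eq0.
  under eq_bigr => s _ do rewrite trAE.
  by rewrite -rmorph_sum /= => /complexI.
have [||L [[PLP L'L LL'] KE]] := @scaled_partial_isometry _ _ P (K s)
    (Num.sqrt (p s))%:C hP (PK s) (KP s).
- exact: conjc_real.
- by rewrite -/(A s) A_scalar trAE -rmorphM -expr2 /= sqr_sqrtr.
by exists L; split.
Qed.
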